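(* Let $$S_0=\begin{pmatrix}1&0&1&0\\1&0&0&1\\0&1&0&1\end{pmatrix},\qquad S_1=\begin{pmatrix}1&0&0&1\\1&0&1&0\\0&1&0&1\end{pmatrix}.$$ Then $\mathrm{Ex}(S_0,n)\ge n2^{\sqrt{\log n}-O(\log\log n)}$ and $\mathrm{Ex}(S_1,n)\ge n2^{\sqrt{\log n}-O(\log\log n)}$; that is, there are constants $C,n_0$ such that for all $n\ge n_0$ both $\mathrm{Ex}(S_0,n)$ and $\mathrm{Ex}(S_1,n)$ are at least $n2^{\sqrt{\log n}-C\log\log n}$.
   Context: A pattern is a 0--1 matrix. A 0--1 matrix $A$ contains a pattern $P$ if $A$ can be transformed into $P$ by removing rows and columns from $A$ (keeping the order of the remaining ones) and changing some 1s to 0s; otherwise $A$ is $P$-free. $\mathrm{Ex}(P,n)$ is the maximum number of 1s in an $n\times n$ 0--1 matrix that is $P$-free. $\log$ is the binary logarithm. *)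

(* Defs.v *)
From mathcomp Require Import all_boot all_order all_algebra.
From mathcomp Require Import all_classical all_reals all_analysis.

Set Implicit Arguments.
Unset Strict Implicit.
Unset Printing Implicit Defensive.

Import Order.TTheory GRing.Theory Num.Theory.

Local Open Scope ring_scope.

Definition increasing (k m : nat) (f : 'I_k -> 'I_m) : bool :=
  [forall i : 'I_k, forall j : 'I_k, (i < j)%N ==> (f i < f j)%N].

(* The rows and columns of A that are kept are listed in order by f and g;
   the implication accounts for changing some 1s of the submatrix to 0s. *)
Definition contains (m n k l : nat) (A : 'M[bool]_(m, n)) (P : 'M[bool]_(k, l))
    : bool :=
  [exists f : {ffun 'I_k -> 'I_m}, exists g : {ffun 'I_l -> 'I_n},
    [&& increasing f, increasing g &
        [forall i, forall j, P i j ==> mxsub f g A i j]]].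

Definition weight (m n : nat) (A : 'M[bool]_(m, n)) : nat :=
  #|[set ij : 'I_m * 'I_n | A ij.1 ij.2]|.

Definition Ex (k l : nat) (P : 'M[bool]_(k, l)) (n : nat) : nat :=
  (\max_(A : 'M[bool]_n | ~~ contains A P) weight A)%N.

Definition pattern_of (k l : nat) (rows : seq (seq nat)) : 'M[bool]_(k, l) :=
  \matrix_(i < k, j < l) (nth 0%N (nth [::] rows i) j == 1%N).

Definition S0 : 'M[bool]_(3, 4) :=
  pattern_of 3 4 [:: [:: 1; 0; 1; 0];
                     [:: 1; 0; 0; 1];
                     [:: 0; 1; 0; 1]]%N.

Definition S1 : 'M[bool]_(3, 4) :=
  pattern_of 3 4 [:: [:: 1; 0; 0; 1];
                     [:: 1; 0; 1; 0];
                     [:: 0; 1; 0; 1]]%N.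

Definition log2 (R : realType) (x : R) : R := ln x / ln 2.

(* Main.v *)
Require Import Defs.
From mathcomp Require Import all_boot all_order all_algebra.
From mathcomp Require Import all_classical all_reals all_analysis.
From mathcomp Require Import zify ring lra.

(** Rows are the points [(u, y_1, .., y_m)] of a box with [u < q = 2 ^ m], and
    columns are the lines of direction [(1, d)] with [d] in [{0, -1} ^ m]. There
    are enough of both for the incidence matrix to have about [n * q] ones when
    [log2 n] is [m ^ 2] up to lower-order terms. Points are ordered by [u] first;
    lines are ordered lexicographically by the pairs ([d_k], offset in the
    [(u, y_k)]-plane).

    In [S0] as in [S1] there are columns [L0 < L1 < L2 < L3] and rows [p], [x], [z]
    with [x < z], [x] on [L0] and [L3], [p] on [L0] and [L2], [z] on [L3] and [L1].
    At the first [k] where [L0] and [L3] differ in the [(u, y_k)]-plane they meet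
    at [x], so [L0] is horizontal there and [L3] has slope [-1]. If [L2] is
    horizontal it coincides with [L0] through [p], hence so does [L1], and [z] would
    be a second common point of [L0] and [L3]; dually [L1] cannot have slope [-1].
    So [L1] is the horizontal line through [z], which lies below [L0] as [x < z],
    against [L0 < L1]. *)

Import Order.TTheory GRing.Theory Num.Theory.
Local Open Scope ring_scope.

(** * Positional digits and the lexicographic order *)

Definition digit (B k x : nat) : nat := ((x %/ B ^ k) %% B)%N.

Definition undigits (B m : nat) (g : nat -> nat) : nat :=
  (\sum_(k < m) g k * B ^ k)%N.

Lemma digitMDl B m k x y : (0 < B)%N -> (k < m)%N ->
  digit B k (y * B ^ m + x) = digit B k x.
Proof.
move=> B0 km; rewrite /digit -(subnK km) addnC (expnD B (m - k.+1)) expnS.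
rewrite addnC !mulnA divnMDl ?expn_gt0 ?B0//.
by rewrite -modnDml modnMl add0n.
Qed.

Lemma ltn_undigits B m g :
  (forall k, (g k < B)%N) -> (undigits B m g < B ^ m)%N.
Proof.
move=> gB; rewrite /undigits; elim: m => [|m IH]; first by rewrite big_ord0.
rewrite big_ord_recr /= expnS.
apply: leq_trans (leq_mul (gB m) (leqnn (B ^ m))).
by rewrite mulSn ltn_add2r.
Qed.

Lemma digit_undigits B m g k : (forall k, (g k < B)%N) -> (k < m)%N ->
  digit B k (undigits B m g) = g k.
Proof.
move=> gB; have B0 : (0 < B)%N by apply: leq_trans (gB 0%N).
elim: m => // m IH; rewrite ltnS leq_eqVlt /undigits big_ord_recr /= addnC.
move=> /orP[/eqP->|km]; last by rewrite digitMDl// IH.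
rewrite /digit divnMDl ?expn_gt0 ?B0//.
by rewrite divn_small ?addn0 ?modn_small// ltn_undigits.
Qed.

Lemma eq_digits B m x y : (x < B ^ m)%N -> (y < B ^ m)%N ->
  (forall k, (k < m)%N -> digit B k x = digit B k y) -> x = y.
Proof.
elim: m x y => [|m IH] x y; first by rewrite expn0 !ltnS !leqn0 => /eqP-> /eqP->.
case: B IH => [|B] IH; first by rewrite exp0n.
rewrite expnS mulnC => xB yB eqd.
have := eqd 0%N isT; rewrite /digit expn0 !divn1 => eq0.
rewrite (divn_eq x B.+1) (divn_eq y B.+1) eq0; congr (_ * _ + _)%N.
apply: IH; rewrite ?ltn_divLR// => k km.
by have := eqd k.+1 km; rewrite /digit expnS !divnMA.
Qed.

Lemma divn_expS B k x : (x %/ B ^ k = x %/ B ^ k.+1 * B + digit B k x)%N.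
Proof. by rewrite expnSr divnMA -divn_eq. Qed.

(** Take for [k] the highest position at which [x0] and [x3] differ. Above it [x1] and [x2] are
    squeezed to the same digits, so at [k] comparing quotients amounts to comparing digits. *)
Lemma first_digit B m x0 x1 x2 x3 :
  (0 < B)%N -> (x0 <= x1)%N -> (x1 <= x2)%N -> (x2 <= x3)%N -> (x0 < x3)%N ->
  (x3 < B ^ m)%N ->
  exists2 k, (k < m)%N &
    [/\ (digit B k x0 <= digit B k x1)%N, (digit B k x1 <= digit B k x2)%N,
        (digit B k x2 <= digit B k x3)%N & (digit B k x0 < digit B k x3)%N].
Proof.
move=> B0 x01 x12 x23 x03 x3B.
have [k km [eqk ltk]] : exists2 k, (k < m)%N &
    (x0 %/ B ^ k.+1 = x3 %/ B ^ k.+1)%N /\ (x0 %/ B ^ k < x3 %/ B ^ k)%N.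
  have eqm : (x0 %/ B ^ m = x3 %/ B ^ m)%N.
    by rewrite !divn_small ?(ltn_trans x03).
  elim: m eqm {x3B} => [|m IH] eqm.
    by move: eqm; rewrite expn0 !divn1 => eqm; rewrite eqm ltnn in x03.
  have [/IH[k km kP]|neq] := eqVneq (x0 %/ B ^ m)%N (x3 %/ B ^ m)%N.
    by exists k; rewrite // ltnS ltnW.
  by exists m => //; split=> //; rewrite ltn_neqAle neq leq_div2r// ltnW.
exists k => //.
have le01 j := leq_div2r (B ^ j) x01.
have le12 j := leq_div2r (B ^ j) x12.
have le23 j := leq_div2r (B ^ j) x23.
have eq1 : (x1 %/ B ^ k.+1 = x0 %/ B ^ k.+1)%N.
  by apply/eqP; rewrite eqn_leq le01 eqk (leq_trans (le12 _)).
have eq2 : (x2 %/ B ^ k.+1 = x0 %/ B ^ k.+1)%N.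
  by apply/eqP; rewrite eqn_leq (leq_trans (le01 _))// eqk le23.
move: (le01 k) (le12 k) (le23 k) ltk.
by rewrite !(divn_expS B k) eq1 eq2 -eqk !leq_add2l ltn_add2l.
Qed.

(** * The incidence matrix of points and lines *)

(* The ordinate at abscissa [u] of the line coded by the digit [c < 2 * S]:
   horizontal if [c < S], of slope [-1] otherwise; the shift by [q] keeps the
   subtraction from being truncated. *)
Definition height (q S u c : nat) : nat :=
  if (c < S)%N then (c + q)%N else (c - S + (q - u))%N.

(** The abscissa of row [i] is its quotient by [(S + q) ^ m], and the [m] digits below it are the
    ordinates. The two bounds pad the matrix with zero rows and columns up to size [n]. *)
Definition line_matrix (n m q S : nat) : 'M[bool]_n :=
  \matrix_(i, j)
    [&& (i < q * (S + q) ^ m)%N, (j < (2 * S) ^ m)%N &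
     [forall k : 'I_m, digit (S + q) k i ==
        height q S (i %/ (S + q) ^ m) (digit (2 * S) k j)]].

Section LineMatrix.
Variables n m q S : nat.
Hypothesis q_gt0 : (0 < q)%N.
Hypothesis S_gt0 : (0 < S)%N.
Let A := line_matrix n m q S.
Let abscissa (i : nat) : nat := (i %/ (S + q) ^ m)%N.

Lemma line_matrixP (i j : 'I_n) : A i j ->
  [/\ (abscissa i < q)%N, (j < (2 * S) ^ m)%N & forall k, (k < m)%N ->
    digit (S + q) k i = height q S (abscissa i) (digit (2 * S) k j)].
Proof.
rewrite mxE => /and3P[iq jB /forallP eqd]; split=> //.
  by rewrite /abscissa ltn_divLR ?expn_gt0 ?addn_gt0 ?S_gt0.
by move=> k km; apply/eqP: (eqd (Ordinal km)).
Qed.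

(** A line is a graph over [u]: the abscissa fixes all digits of the row, hence the row. *)
Lemma line_abscissa_inj (i i' j : 'I_n) :
  A i j -> A i' j -> abscissa i = abscissa i' -> i = i'.
Proof.
move=> /line_matrixP[iq _ di] /line_matrixP[iq' _ di'] eqa.
have Y0 : (0 < (S + q) ^ m)%N by rewrite expn_gt0 addn_gt0 S_gt0.
apply: val_inj => /=.
rewrite (divn_eq i ((S + q) ^ m)) (divn_eq i' ((S + q) ^ m)).
rewrite -/(abscissa i) -/(abscissa i') eqa; congr (_ + _)%N.
apply: (eq_digits (S + q) m); rewrite ?ltn_pmod// => k km.
have modd x : digit (S + q) k (x %% (S + q) ^ m) = digit (S + q) k x.
  by rewrite {2}(divn_eq x ((S + q) ^ m)) digitMDl// addn_gt0 S_gt0.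
by rewrite !modd di// di'// eqa.
Qed.

(** Here [i], [i'], [i''] are the points p, x, z of the overview. The two patterns differ only in
    the order of p and x, so [i != i'] serves both. *)
Lemma line_matrix_free (i i' i'' j0 j1 j2 j3 : 'I_n) :
  i != i' -> (i' < i'')%N -> (j0 < j1)%N -> (j1 < j2)%N -> (j2 < j3)%N ->
  ~ [/\ A i j0, A i j2, A i' j0, A i' j3 & A i'' j3 /\ A i'' j1].
Proof.
move=> ii' ii'' j01 j12 j23 [Ai0 Ai2 Ai'0 Ai'3 [Ai''3 Ai''1]].
have ne : abscissa i != abscissa i'.
  by apply: contra ii' => /eqP/(line_abscissa_inj _ _ _ Ai0 Ai'0)->.
have lt : (abscissa i' < abscissa i'')%N.
  rewrite ltn_neqAle leq_div2r 1?ltnW// andbT.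
  apply/eqP => /(line_abscissa_inj _ _ _ Ai'3 Ai''3) eqi.
  by rewrite eqi ltnn in ii''.
have [_ _ d0] := line_matrixP _ _ Ai0.
have [a1 _ d2] := line_matrixP _ _ Ai2.
have [_ _ d0'] := line_matrixP _ _ Ai'0.
have [a2 _ d3'] := line_matrixP _ _ Ai'3.
have [_ j3B d3''] := line_matrixP _ _ Ai''3.
have [a3 _ d1''] := line_matrixP _ _ Ai''1.
have [|||||//|k km [c01 c12 c23 c03]] := first_digit (2 * S) m j0 j1 j2 j3.
- by rewrite muln_gt0 S_gt0.
- exact: ltnW.
- exact: ltnW.
- exact: ltnW.
- by rewrite (ltn_trans j01)// (ltn_trans j12).
(* Eliminating the digits of the rows leaves three equations of heights: [j0] and [j2] at p, [j0]
   and [j3] at x, [j3] and [j1] at z. The 16 choices of slopes are then linear arithmetic. *)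
move: (d0 k km) (d2 k km) (d0' k km) (d3' k km) (d3'' k km) (d1'' k km).
move=> -> + -> + -> +.
move: (digit _ k j0) (digit _ k j1) (digit _ k j2) (digit _ k j3) c01 c12 c23 c03.
move: (abscissa i) (abscissa i') (abscissa i'') ne lt a1 a2 a3.
rewrite /height => u u' u'' ne lt a1 a2 a3 c0 c1 c2 c3 c01 c12 c23 c03.
by do 4 case: ifP; lia.
Qed.

Lemma height_lt u c : (c < 2 * S)%N -> (height q S u c < S + q)%N.
Proof. by rewrite /height; case: ifP; lia. Qed.

(** Over each of the [q] abscissas every line has a point of the box, since heights stay below
    [S + q]. *)
Lemma weight_line_matrix : (q * (S + q) ^ m <= n)%N -> ((2 * S) ^ m <= n)%N ->
  (q * (2 * S) ^ m <= weight A)%N.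
Proof.
move=> rown coln.
have B0 : (0 < 2 * S)%N by rewrite muln_gt0 S_gt0.
have Y0 : (0 < (S + q) ^ m)%N by rewrite expn_gt0 addn_gt0 S_gt0.
pose g (u j k : nat) := height q S u (digit (2 * S) k j).
have gY u j k : (g u j k < S + q)%N by rewrite height_lt// ltn_pmod.
pose r u j := (u * (S + q) ^ m + undigits (S + q) m (g u j))%N.
have rE u j : (r u j %/ (S + q) ^ m)%N = u.
  by rewrite divnMDl// divn_small ?addn0// ltn_undigits.
have rlt (u : 'I_q) j : (r u j < q * (S + q) ^ m)%N.
  by rewrite -ltn_divLR ?rE.
pose f (x : 'I_q * 'I_((2 * S) ^ m)) : 'I_n * 'I_n :=
  (Ordinal (leq_trans (rlt x.1 x.2) rown), widen_ord coln x.2).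
have f_inj : injective f.
  move=> [u j] [u' j'] [] /= eqr eqj; have ejj : j = j' by apply: val_inj.
  congr (_, _) => //; apply: val_inj => /=.
  by rewrite -(rE u j) eqr rE.
have -> : (q * (2 * S) ^ m = #|[set f x | x in [set: 'I_q * 'I_((2 * S) ^ m)]]|)%N.
  by rewrite card_imset// cardsT card_prod !card_ord.
rewrite /weight subset_leq_card//; apply/fintype.subsetP => _ /imsetP[[u j] _ ->].
rewrite inE mxE /= rlt ltn_ord /=; apply/forallP => k.
by rewrite rE digitMDl ?addn_gt0 ?S_gt0// digit_undigits.
Qed.

End LineMatrix.

(** * Avoidance of the two patterns *)

Lemma containsP m n k l (A : 'M[bool]_(m, n)) (P : 'M[bool]_(k, l)) :
  contains A P -> exists (f : 'I_k -> 'I_m) (g : 'I_l -> 'I_n),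
    [/\ forall i j : 'I_k, (i < j)%N -> (f i < f j)%N,
    forall i j : 'I_l, (i < j)%N -> (g i < g j)%N &
    forall i j, P i j -> A (f i) (g j)].
Proof.
move=> /existsP[f /existsP[g /and3P[/forallP incf /forallP incg /forallP PA]]].
exists f, g; split=> i j.
- by move/forallP: (incf i) => /(_ j) /implyP.
- by move/forallP: (incg i) => /(_ j) /implyP.
- by move/forallP: (PA i) => /(_ j) /implyP; rewrite mxE.
Qed.

Lemma line_matrix_S0_free n m q S : (0 < q)%N -> (0 < S)%N ->
  ~~ contains (line_matrix n m q S) S0.
Proof.
move=> q_gt0 S_gt0; apply/negP => /containsP[f [g [incf incg PA]]].
pose r (k : nat) : 'I_3 := inord k; pose c (k : nat) : 'I_4 := inord k.
apply: (line_matrix_free n m q S q_gt0 S_gt0 (f (r 0%N)) (f (r 1%N)) (f (r 2%N))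
  (g (c 0%N)) (g (c 1%N)) (g (c 2%N)) (g (c 3%N))).
- by rewrite -val_eqE /= ltn_eqF// incf// !inordK.
- by rewrite incf// !inordK.
- by rewrite incg// !inordK.
- by rewrite incg// !inordK.
- by rewrite incg// !inordK.
by split; [..|split]; apply: PA; rewrite mxE !inordK.
Qed.

Lemma line_matrix_S1_free n m q S : (0 < q)%N -> (0 < S)%N ->
  ~~ contains (line_matrix n m q S) S1.
Proof.
move=> q_gt0 S_gt0; apply/negP => /containsP[f [g [incf incg PA]]].
pose r (k : nat) : 'I_3 := inord k; pose c (k : nat) : 'I_4 := inord k.
apply: (line_matrix_free n m q S q_gt0 S_gt0 (f (r 1%N)) (f (r 0%N)) (f (r 2%N))
  (g (c 0%N)) (g (c 1%N)) (g (c 2%N)) (g (c 3%N))).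
- by rewrite -val_eqE /= gtn_eqF// incf// !inordK.
- by rewrite incf// !inordK.
- by rewrite incg// !inordK.
- by rewrite incg// !inordK.
- by rewrite incg// !inordK.
by split; [..|split]; apply: PA; rewrite mxE !inordK.
Qed.

Lemma leq_weight_Ex k l (P : 'M[bool]_(k, l)) n (A : 'M[bool]_n) :
  ~~ contains A P -> (weight A <= Ex P n)%N.
Proof.
exact: (@leq_bigmax_cond _ (fun A => ~~ contains A P) (@weight n n) A).
Qed.

(** * Choice of the box size for a given [n] *)

(** Bernoulli's inequality for [(1 - k / T) ^ m], cleared of denominators and with the negative term
    moved across. *)
Lemma bernoulli_expn T k m : (k <= T)%N ->
  (T ^ m * T <= (T - k) ^ m * T + m * k * T ^ m)%N.
Proof.
move=> kT; elim: m => [|m IH]; first by rewrite !expn0; lia.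
have le : (k * (T - k) ^ m * T <= k * T ^ m * T)%N.
  by rewrite !leq_mul//; case: m {IH} => // m; rewrite leq_exp2r// leq_subr.
have : ((T - k) ^ m * T * (T - k) + (T - k) ^ m * T * k = (T - k) ^ m * T * T)%N.
  by rewrite -mulnDr subnK.
move: le (leq_mul IH (leqnn T)); rewrite !expnSr.
move: ((T - k) ^ m)%N (T ^ m)%N => a b; nia.
Qed.

Lemma expn_sub_half T k m : (0 < T)%N -> (k <= T)%N -> (2 * m * k <= T)%N ->
  (T ^ m <= 2 * (T - k) ^ m)%N.
Proof.
move=> T0 kT mkT; rewrite -(leq_pmul2r T0).
have := bernoulli_expn T k m kT; move: (leq_mul mkT (leqnn (T ^ m))).
move: ((T - k) ^ m)%N (T ^ m)%N => a b; nia.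
Qed.

(** As [q = 2 ^ m], the number of lines [(2 * S) ^ m] is [q * S ^ m], so lines and points fill [n]
    together up to a constant factor. *)
Lemma line_matrix_size n m : (0 < m)%N -> (2 ^ m * (4 * m * 2 ^ m) ^ m <= n)%N ->
  exists2 S, (0 < S)%N &
  [/\ (2 ^ m * (S + 2 ^ m) ^ m <= n)%N, ((2 * S) ^ m <= n)%N &
      (n <= 2 * (2 * S) ^ m)%N].
Proof.
move=> m0 len; set q := (2 ^ m)%N in len *.
have q0 : (0 < q)%N by rewrite expn_gt0.
have bd Y : (q * Y ^ m <= n)%N -> (Y <= n)%N.
  move=> Yn; apply: leq_trans Yn; case: Y => // Y.
  by rewrite -{1}[Y.+1]expn1 (leq_trans (leq_pexp2l _ m0))// leq_pmull.
have exY : exists Y, (q * Y ^ m <= n)%N by exists (4 * m * q)%N.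
(* [Y] plays the role of [S + q], taken as large as the rows allow. *)
case: (ex_maxnP exY bd) => Y Yn Ymax.
have leY := Ymax _ len.
have mq0 : (q <= m * q)%N by rewrite leq_pmull.
have ltY : (n < q * Y.+1 ^ m)%N by rewrite ltnNge; apply/negP => /Ymax; rewrite ltnn.
exists (Y - q)%N; first by lia.
rewrite subnK; last by lia.
have leSY : ((2 * (Y - q)) ^ m <= q * Y ^ m)%N.
  by rewrite expnMn leq_mul2l leq_exp2r// leq_subr orbT.
split=> //; first exact: leq_trans leSY Yn.
apply: leq_trans (ltnW ltY) _.
rewrite expnMn -/q mulnCA leq_mul2l.
(* Passing from [Y.+1] to [Y - q] at most halves the [m]-th power, because
   [2 * m * q.+1 <= 4 * m * q <= Y]. *)
have -> : (Y - q = Y.+1 - q.+1)%N by lia.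
by rewrite expn_sub_half ?orbT//; nia.
Qed.

Lemma Ex_S0_S1_ge n m : (0 < m)%N -> (2 ^ m * (4 * m * 2 ^ m) ^ m <= n)%N ->
  (n * 2 ^ m <= 2 * Ex S0 n)%N /\ (n * 2 ^ m <= 2 * Ex S1 n)%N.
Proof.
move=> m0 len; have [S S_gt0 [rown coln nle]] := line_matrix_size n m m0 len.
have q_gt0 : (0 < 2 ^ m)%N by rewrite expn_gt0.
have wA : (n * 2 ^ m <= 2 * weight (line_matrix n m (2 ^ m) S))%N.
  have := weight_line_matrix n m _ S q_gt0 S_gt0 rown coln.
  rewrite -(leq_pmul2l (ltn0Sn 1)); apply: leq_trans.
  by rewrite mulnCA mulnC leq_mul.
have le P : ~~ contains (line_matrix n m (2 ^ m) S) P ->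
    (n * 2 ^ m <= 2 * @Ex 3 4 P n)%N.
  by move=> /leq_weight_Ex wE; rewrite (leq_trans wA)// leq_mul2l.
by split; apply: le; [exact: line_matrix_S0_free|exact: line_matrix_S1_free].
Qed.

(** * Logarithmic estimates and the choice of [m] *)

Lemma ln2_ge_half (R : realType) : 2^-1 <= ln 2 :> R.
Proof.
have := @le_ln1Dx R (- 2^-1) ltac:(lra).
have -> : 1 - 2^-1 = 2^-1 :> R by lra.
by rewrite lnV ?posrE//; lra.
Qed.

(** Used with [w] the fourth root of [log2 n], to keep [log2 (log2 n)] below [Num.sqrt (log2 n)]. *)
Lemma log2_lt (R : realType) (w : R) : 0 < w -> log2 (w ^+ 4) < 8 * w.
Proof.
move=> w0; rewrite /log2 lnXn// ltr_pdivrMr; last by have := ln2_ge_half R; lra.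
have := ln_sublinear w0; have := ln2_ge_half R; nra.
Qed.

Lemma powR2_log2 (R : realType) (x : R) : 0 < x -> 2 `^ log2 x = x.
Proof.
move=> x0; rewrite /powR pnatr_eq0 /= /log2 divfK ?lnK//.
by apply: lt0r_neq0; have := ln2_ge_half R; lra.
Qed.

Lemma log2_ge_near (R : realType) (k : nat) : exists n0 : nat,
  forall n, (n0 <= n)%N -> (0 < n)%N /\ k%:R <= log2 (n%:R : R).
Proof.
exists (2 ^ k)%N => n kn; have ln2 := ln2_ge_half R.
have n0 : (0 < n)%N by rewrite (leq_trans _ kn) ?expn_gt0.
split=> //; rewrite /log2 ler_pdivlMr; last by lra.
rewrite mulr_natl -lnXn// ler_ln ?posrE ?exprn_gt0 ?ltr0n//.
by rewrite -natrX ler_nat.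
Qed.

(** The left side is [(8 * m * 2 ^ m) ^ m]. Its base is at most [2 ^ sqrt L], since
    [2 ^ m <= 2 ^ sqrt L / L] and [8 * m <= 8 * sqrt L <= L]; and [m <= sqrt L]. *)
Lemma line_matrix_fits (R : realType) (n m : nat) (L : R) :
  (0 < n)%N -> L = log2 n%:R -> 64 <= L -> m%:R <= Num.sqrt L - log2 L ->
  (2 ^ m * (4 * m * 2 ^ m) ^ m <= n)%N.
Proof.
move=> n0 LE L64 mL; have L0 : 0 < L by lra.
rewrite -expnMn -(ler_nat R) natrX.
have sq : Num.sqrt L * Num.sqrt L = L by rewrite -expr2 sqr_sqrtr// ltW.
have s8 : 8 <= Num.sqrt L.
  by rewrite -ler_sqr ?nnegrE ?sqrtr_ge0// sqr_sqrtr; lra.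
have lgL : 0 <= log2 L.
  by apply: divr_ge0; apply: ln_ge0; lra.
have base : (2 * (4 * m * 2 ^ m))%:R <= 2 `^ Num.sqrt L :> R.
  have /(ler_powR (ler1n R 2)) : m%:R <= Num.sqrt L - log2 L by [].
  rewrite powR_mulrn// powRB ?pnatr_eq0 ?implybT// powR2_log2// ler_pdivlMr//.
  rewrite !natrM natrX => le; apply: le_trans le.
  have -> : 2 * (4 * m%:R * 2 ^+ m) = 2 ^+ m * (8 * m%:R) :> R by ring.
  by rewrite ler_wpM2l// -sq; nra.
apply: le_trans (lerXn2r m _ _ base) _; rewrite ?nnegrE ?ler0n ?powR_ge0//.
rewrite -powR_mulrn ?powR_ge0// -powRrM -[leRHS]powR2_log2 ?ltr0n// -LE.
apply: ler_powR; first by rewrite ler1n.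
by rewrite -{2}sq; nra.
Qed.

Theorem theorem1p2 (R : realType) :
  exists (C : R) (n0 : nat), forall n : nat, (n0 <= n)%N ->
    n%:R * 2 `^ (Num.sqrt (log2 n%:R) - C * log2 (log2 n%:R)) <= (Ex S0 n)%:R
    /\
    n%:R * 2 `^ (Num.sqrt (log2 n%:R) - C * log2 (log2 n%:R)) <= (Ex S1 n)%:R.
Proof.
(* The bound gives [w >= 9] for the fourth root [w] of [L], so [sqrt L - log2 L > w * (w - 8) >= 9]
   and [m] is positive. *)
have [n0 n0P] := log2_ge_near R (9 ^ 4).
(* One [log2 L] is spent on the choice of [m]; the second, being at least 2, absorbs the rounding of
   [m] and the factor 2 in [Ex_S0_S1_ge]. *)
exists 2, n0 => n /n0P[n_gt0]; rewrite natrX; set L := log2 n%:R => leL.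
have L64 : 64 <= L by lra.
have L0 : 0 <= L by lra.
pose w := Num.sqrt (Num.sqrt L).
have w2 : w ^+ 2 = Num.sqrt L by rewrite sqr_sqrtr// sqrtr_ge0.
have w4 : w ^+ 4 = L by rewrite (exprM w 2 2) w2 sqr_sqrtr.
have w9 : 9 <= w by rewrite -(@ler_pXn2r _ 4) ?nnegrE ?sqrtr_ge0// w4.
have lgL : log2 L < 8 * w by rewrite -w4 log2_lt//; lra.
have sL : 1 <= Num.sqrt L - log2 L.
  have : 9 <= w * (w - 8) by rewrite (le_trans w9)// ler_peMr; lra.
  by rewrite -w2; lra.
have lg2 : 2 <= log2 L.
  rewrite /log2 ler_pdivlMr; last by have := ln2_ge_half R; lra.
  by rewrite mulr_natl -lnXn// ler_ln ?posrE//; lra.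
pose m := Num.truncn (Num.sqrt L - log2 L).
have /andP[mle] : m%:R <= Num.sqrt L - log2 L < m.+1%:R by apply: truncn_itv; lra.
rewrite -addn1 natrD => mgt.
have m0 : (0 < m)%N by rewrite truncn_gt0.
have cond := line_matrix_fits R n m L n_gt0 erefl L64 mle.
have conclude E : (n * 2 ^ m <= 2 * E)%N ->
    n%:R * 2 `^ (Num.sqrt L - 2 * log2 L) <= E%:R.
  rewrite -(ler_nat R) !natrM natrX => nE.
  have : 2 `^ (Num.sqrt L - 2 * log2 L) <= 2 `^ (m%:R - 1).
    apply: ler_powR; first by rewrite ler1n.
    by clear -mgt lg2; lra.
  rewrite [leRHS]powRB ?pnatr_eq0 ?implybT// powRr1// powR_mulrn// => le.
  apply: le_trans (ler_wpM2l (ler0n _ n) le) _.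
  by rewrite mulrA ler_pdivrMr// [leRHS]mulrC.
by have [/conclude ? /conclude ?] := Ex_S0_S1_ge n m m0 cond.
Qed.
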